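(* Let $\mathcal{C}$ be a pivotal finite tensor category over a field $\Bbbk$ with pivotal structure $\mathfrak{p}$. An algebra in $\mathcal{C}$ that is Morita equivalent to a symmetric Frobenius algebra in $\mathcal{C}$ is also symmetric Frobenius (i.e. it admits a Frobenius form making it a symmetric Frobenius algebra).
   Context: $\Bbbk$ is an arbitrary field. A finite abelian category is a $\Bbbk$-linear category equivalent to the category of finite-dimensional right modules over a finite-dimensional $\Bbbk$-algebra. A finite tensor category is a finite abelian category $\mathcal{C}$ with a rigid monoidal structure (assumed strict) with bilinear $\otimes$ and simple unit object $\mathbf{1}$. The left dual $X^*$ comes with $\mathrm{ev}_X:X^*\otimes X\to\mathbf{1}$, $\mathrm{coev}_X:\mathbf{1}\to X\otimes X^*$. A pivotal structure on $\mathcal{C}$ is a monoidal natural isomorphism $\mathfrak{p}_X:X\to X^{**}$. For an algebra $A$ in $\mathcal{C}$, the category $\mathcal{C}_A$ of right $A$-modules in $\mathcal{C}$ is a left $\mathcal{C}$-module category by $X\triangleright M=X\otimes M$. Algebras $A,B$ in $\mathcal{C}$ are Morita equivalent if $\mathcal{C}_A$ and $\mathcal{C}_B$ are equivalent as left $\mathcal{C}$-module categories. A Frobenius algebra in $\mathcal{C}$ is an algebra $A$ with multiplication $m_A$ equipped with a Frobenius form, i.e. a morphism $\lambda:A\to\mathbf{1}$ such that $\phi_A:=(\lambda m_A\otimes\mathrm{id}_{A^*})\circ(\mathrm{id}_A\otimes\mathrm{coev}_A):A\to A^*$ is an isomorphism. Its Nakayama isomorphism is $\nu_A=\phi_A^{-1}\circ\phi_A^*:A^{**}\to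 A$. The Frobenius algebra $A$ is symmetric if $\nu_A\circ\mathfrak{p}_A=\mathrm{id}_A$. *)

(* Defs.v *)
From HB Require Import structures.
From mathcomp Require Import all_boot all_algebra all_field.
From mathcomp Require Import boolp.

Set Implicit Arguments.
Unset Strict Implicit.
Unset Printing Implicit Defensive.

Import GRing.Theory.
Local Open Scope ring_scope.

Declare Scope cat_scope.
Delimit Scope cat_scope with cat.
Local Open Scope cat_scope.

Lemma linear_at0 (R : pzRingType) (U V : lmodType R) (h : U -> V) :
  linear h -> h 0 = 0.
Proof. by move=> /(_ (-1) 0 0); rewrite !scaleN1r oppr0 addr0 addNr. Qed.

Record category (k : fieldType) := Category {
  obj :> Type;
  hom : obj -> obj -> lmodType k;
  idm : forall X, hom X X;
  comp : forall X Y Z, hom Y Z -> hom X Y -> hom X Z;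
  compIm : forall X Y (f : hom X Y), comp (idm Y) f = f;
  compmI : forall X Y (f : hom X Y), comp f (idm X) = f;
  compA : forall X Y Z W (h : hom Z W) (g : hom Y Z) (f : hom X Y),
    comp h (comp g f) = comp (comp h g) f;
  comp_linearl : forall X Y Z (f : hom X Y),
    linear (fun g : hom Y Z => comp g f);
  comp_linearr : forall X Y Z (g : hom Y Z),
    linear (fun f : hom X Y => comp g f) }.

Notation "g ∘ f" := (comp g f) (at level 40, left associativity) : cat_scope.

Section CategoryNotions.
Variables (k : fieldType) (C : category k).

Definition inverse_pair (X Y : C) (f : hom X Y) (g : hom Y X) : Prop :=
  g ∘ f = idm X /\ f ∘ g = idm Y.

Lemma inverse_pair_epi (X Y : C) (e : hom X Y) d :
  inverse_pair e d -> forall Z (f g : hom Y Z), f ∘ e = g ∘ e -> f = g.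
Proof.
by move=> [_ ed] Z f g eq; rewrite -[f]compmI -[g]compmI -ed !compA eq.
Qed.

Lemma inverse_pair_mono (X Y : C) (e : hom X Y) d :
  inverse_pair e d -> forall Z (f g : hom Z X), e ∘ f = e ∘ g -> f = g.
Proof.
by move=> [de _] Z f g eq; rewrite -[f]compIm -[g]compIm -de -!compA eq.
Qed.

Definition is_iso (X Y : C) (f : hom X Y) : Prop :=
  exists g : hom Y X, inverse_pair f g.

Definition is_mono (X Y : C) (f : hom X Y) : Prop :=
  forall (Z : C) (g h : hom Z X), f ∘ g = f ∘ h -> g = h.

Definition is_zero (X : C) : Prop := idm X = 0.

Definition simple (X : C) : Prop :=
  ~ is_zero X /\
  forall (S : C) (i : hom S X), is_mono i -> is_zero S \/ is_iso i.

End CategoryNotions.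

Record functor (k : fieldType) (C D : category k) := Functor {
  fobj :> C -> D;
  fmap : forall X Y : C, hom X Y -> hom (fobj X) (fobj Y);
  fmap_id : forall X, fmap (idm X) = idm (fobj X);
  fmap_comp : forall X Y Z (g : hom Y Z) (f : hom X Y),
    fmap (g ∘ f) = fmap g ∘ fmap f;
  fmap_linear : forall X Y, linear (@fmap X Y) }.

Section Functors.
Variable k : fieldType.

Definition id_functor (C : category k) : functor C C.
Proof. by exists id (fun X Y f => f). Defined.

Definition comp_functor (C D E : category k) (G : functor D E)
  (F : functor C D) : functor C E.
Proof.
exists (fun X => G (F X)) (fun X Y f => fmap G (fmap F f)).
- by move=> X; rewrite !fmap_id.
- by move=> X Y Z g f; rewrite !fmap_comp.
- by move=> X Y a f g; rewrite !fmap_linear.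
Defined.

Definition nat_isomorphic (C D : category k) (F G : functor C D) : Prop :=
  exists eta : forall X : C, hom (F X) (G X),
    (forall X, is_iso (eta X)) /\
    (forall X Y (f : hom X Y), eta Y ∘ fmap F f = fmap G f ∘ eta X).

Definition is_equivalence (C D : category k) (F : functor C D) : Prop :=
  exists G : functor D C,
    nat_isomorphic (comp_functor G F) (id_functor C) /\
    nat_isomorphic (comp_functor F G) (id_functor D).

End Functors.

Record fdmod (k : fieldType) (R : falgType k) := FdMod {
  fdmod_sort :> vectType k;
  ract : fdmod_sort -> R -> fdmod_sort;
  ract_linearl : forall r, linear (fun v => ract v r);
  ract_linearr : forall v, linear (ract v);
  ract1 : forall v, ract v 1 = v;
  ractM : forall v r s, ract v (r * s) = ract (ract v r) s }.

Section FdModCategory.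
Variables (k : fieldType) (R : falgType k).

Definition fdmod_hom_pred (V W : fdmod R) : pred 'Hom(V, W) :=
  fun f => `[< forall v r, f (ract v r) = ract (f v) r >].
Arguments fdmod_hom_pred : clear implicits.

Lemma fdmod_hom_submod V W : submod_closed (fdmod_hom_pred V W).
Proof.
split=> [|a f g /asboolP hf /asboolP hg]; apply/asboolP => v r.
  by rewrite !lfunE /= (linear_at0 (ract_linearl r)).
by rewrite !lfunE /= !lfunE /= hf hg ract_linearl.
Qed.

HB.instance Definition _ (V W : fdmod R) := GRing.isSubmodClosed.Build k 'Hom(V, W)
  (fdmod_hom_pred V W) (fdmod_hom_submod V W).

Record fdmod_hom (V W : fdmod R) := FdModHom {
  fdmod_lfun :> 'Hom(V, W);
  fdmod_homP : fdmod_hom_pred V W fdmod_lfun }.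

HB.instance Definition _ (V W : fdmod R) := [isSub for @fdmod_lfun V W].
HB.instance Definition _ (V W : fdmod R) := [Choice of fdmod_hom V W by <:].
HB.instance Definition _ (V W : fdmod R) :=
  [SubChoice_isSubLmodule of fdmod_hom V W by <:].

Lemma fdmod_id_subproof V : fdmod_hom_pred V V \1%VF.
Proof. by apply/asboolP => v r; rewrite !lfunE. Qed.

Lemma fdmod_comp_subproof U V W (g : fdmod_hom V W) (f : fdmod_hom U V) :
  fdmod_hom_pred U W (g \o f)%VF.
Proof.
case: g f => g /= /asboolP hg [f /= /asboolP hf]; apply/asboolP => v r.
by rewrite !lfunE /= hf hg.
Qed.

Definition fdmod_category : category k.
Proof.
unshelve refine (@Category k (fdmod R)
  (fun V W => fdmod_hom V W : lmodType k)
  (fun V => FdModHom (fdmod_id_subproof V))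
  (fun U V W g f => FdModHom (fdmod_comp_subproof g f)) _ _ _ _ _).
- by move=> V W f; apply/val_inj; rewrite /= comp_lfun1l.
- by move=> V W f; apply/val_inj; rewrite /= comp_lfun1r.
- by move=> U V W Z h g f; apply/val_inj; rewrite /= comp_lfunA.
- move=> U V W f a g h; apply/val_inj.
  by rewrite /= comp_lfunDl comp_lfunZl.
- move=> U V W g a f h; apply/val_inj.
  by rewrite /= comp_lfunDr comp_lfunZr.
Defined.

End FdModCategory.

(* A falgType is a nonzero algebra; the zero algebra would only add the zero
   category, which has no simple object. *)
Definition finite_abelian (k : fieldType) (C : category k) : Prop :=
  exists (R : falgType k) (F : functor C (fdmod_category R)),
    is_equivalence F.

(* Monoidal categories are not assumed strict: a strict one is the case in
   which assoc, lunit and runit are identities. *)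
Record monoidal_category (k : fieldType) := MonoidalCategory {
  mon_category :> category k;
  tens : mon_category -> mon_category -> mon_category;
  tensm : forall X X' Y Y' : mon_category,
    hom X X' -> hom Y Y' -> hom (tens X Y) (tens X' Y');
  tensm_id : forall X Y, tensm (idm X) (idm Y) = idm (tens X Y);
  tensm_comp : forall X X' X'' Y Y' Y'' (f' : hom X' X'') (f : hom X X')
      (g' : hom Y' Y'') (g : hom Y Y'),
    tensm (f' ∘ f) (g' ∘ g) = tensm f' g' ∘ tensm f g;
  tensm_linearl : forall X X' Y Y' (g : hom Y Y'),
    linear (fun f : hom X X' => tensm f g);
  tensm_linearr : forall X X' Y Y' (f : hom X X'),
    linear (fun g : hom Y Y' => tensm f g);
  one : mon_category;
  assoc : forall X Y Z, hom (tens (tens X Y) Z) (tens X (tens Y Z));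
  assocV : forall X Y Z, hom (tens X (tens Y Z)) (tens (tens X Y) Z);
  lunit : forall X, hom (tens one X) X;
  lunitV : forall X, hom X (tens one X);
  runit : forall X, hom (tens X one) X;
  runitV : forall X, hom X (tens X one);
  assocK : forall X Y Z, inverse_pair (assoc X Y Z) (assocV X Y Z);
  lunitK : forall X, inverse_pair (lunit X) (lunitV X);
  runitK : forall X, inverse_pair (runit X) (runitV X);
  assoc_nat : forall X X' Y Y' Z Z' (f : hom X X') (g : hom Y Y')
      (h : hom Z Z'),
    assoc X' Y' Z' ∘ tensm (tensm f g) h
    = tensm f (tensm g h) ∘ assoc X Y Z;
  lunit_nat : forall X Y (f : hom X Y),
    lunit Y ∘ tensm (idm one) f = f ∘ lunit X;
  runit_nat : forall X Y (f : hom X Y),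
    runit Y ∘ tensm f (idm one) = f ∘ runit X;
  pentagon : forall X Y Z W,
    assoc X Y (tens Z W) ∘ assoc (tens X Y) Z W
    = tensm (idm X) (assoc Y Z W) ∘ assoc X (tens Y Z) W
      ∘ tensm (assoc X Y Z) (idm W);
  triangle : forall X Y,
    tensm (idm X) (lunit Y) ∘ assoc X one Y = tensm (runit X) (idm Y) }.

Arguments assoc {k _} X Y Z.
Arguments assocV {k _} X Y Z.
Arguments lunit {k _} X.
Arguments lunitV {k _} X.
Arguments runit {k _} X.
Arguments runitV {k _} X.
Arguments one {k _}.

Notation "X ⊗ Y" := (tens X Y) (at level 30, right associativity) : cat_scope.
Notation "f ⊠ g" := (tensm f g) (at level 30, right associativity) : cat_scope.
Notation "𝟙" := one : cat_scope.

Section Monoidal.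
Variables (k : fieldType) (C : monoidal_category k).
Implicit Types X Y Z : C.

Lemma tensm_compl X X' X'' Y (f : hom X' X'') (g : hom X X') :
  (f ∘ g) ⊠ idm Y = (f ⊠ idm Y) ∘ (g ⊠ idm Y).
Proof. by rewrite -tensm_comp compIm. Qed.

Lemma tensm_compr X Y Y' Y'' (f : hom Y' Y'') (g : hom Y Y') :
  idm X ⊠ (f ∘ g) = (idm X ⊠ f) ∘ (idm X ⊠ g).
Proof. by rewrite -tensm_comp compIm. Qed.

Lemma tens_inverse_pair X X' Y Y' (f : hom X X') f' (g : hom Y Y') g' :
  inverse_pair f f' -> inverse_pair g g' ->
  inverse_pair (f ⊠ g) (f' ⊠ g').
Proof.
by move=> [f1 f2] [g1 g2]; split; rewrite -tensm_comp ?f1 ?f2 ?g1 ?g2 tensm_id.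
Qed.

Lemma id_inverse_pair X : inverse_pair (idm X) (idm X).
Proof. by split; rewrite compIm. Qed.

Lemma tensm_id_one_inj X Y (f g : hom X Y) :
  idm (𝟙 : C) ⊠ f = idm 𝟙 ⊠ g -> f = g.
Proof.
move=> eq; apply: (inverse_pair_epi (lunitK X)).
by rewrite -!lunit_nat eq.
Qed.

Lemma tensm_one_id_inj X Y (f g : hom X Y) :
  f ⊠ idm (𝟙 : C) = g ⊠ idm 𝟙 -> f = g.
Proof.
move=> eq; apply: (inverse_pair_epi (runitK X)).
by rewrite -!runit_nat eq.
Qed.

Lemma lunit_tens X Y : lunit (X ⊗ Y) ∘ assoc 𝟙 X Y = lunit X ⊠ idm Y.
Proof.
apply: tensm_id_one_inj.
apply: (inverse_pair_epi (assocK 𝟙 (𝟙 ⊗ X) Y)).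
apply: (inverse_pair_epi
  (tens_inverse_pair (assocK 𝟙 𝟙 X) (id_inverse_pair Y))).
rewrite -{1}[idm 𝟙]compIm tensm_comp -!compA.
rewrite [_ ∘ (assoc 𝟙 (𝟙 ⊗ X) Y ∘ _)]compA -pentagon compA triangle.
rewrite -tensm_id -assoc_nat -triangle.
by rewrite -{1}[idm Y]compIm tensm_comp compA assoc_nat compA.
Qed.

Lemma runit_tens X Y : (idm X ⊠ runit Y) ∘ assoc X Y 𝟙 = runit (X ⊗ Y).
Proof.
apply: tensm_one_id_inj.
apply: (inverse_pair_mono (assocK X Y 𝟙)).
rewrite -{1}[idm 𝟙]compIm tensm_comp compA assoc_nat -triangle.
rewrite -{1}[idm X]compIm tensm_comp -!compA.
rewrite [_ ∘ (assoc X (Y ⊗ 𝟙) 𝟙 ∘ _)]compA -pentagon.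
rewrite compA -assoc_nat -compA tensm_id.
by rewrite triangle.
Qed.

End Monoidal.

(* Y is a left dual of X, equivalently X is a right dual of Y. *)
Record duality (k : fieldType) (C : monoidal_category k) (Y X : C) := Duality {
  dual_ev : hom (Y ⊗ X) 𝟙;
  dual_coev : hom 𝟙 (X ⊗ Y);
  dual_zigzagr :
    runit X ∘ (idm X ⊠ dual_ev) ∘ assoc X Y X ∘ (dual_coev ⊠ idm X)
      ∘ lunitV X = idm X;
  dual_zigzagl :
    lunit Y ∘ (dual_ev ⊠ idm Y) ∘ assocV Y X Y ∘ (idm Y ⊠ dual_coev)
      ∘ runitV Y = idm Y }.

Record finite_tensor_category (k : fieldType) := FiniteTensorCategory {
  ftc_monoidal :> monoidal_category k;
  ftc_finite : finite_abelian ftc_monoidal;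
  ldual : ftc_monoidal -> ftc_monoidal;
  ldualP : forall X, duality (ldual X) X;
  rdual : ftc_monoidal -> ftc_monoidal;
  rdualP : forall X, duality X (rdual X);
  one_simple : simple (one : ftc_monoidal) }.

Notation "X ^*" := (ldual X) : cat_scope.

Section Duals.
Variables (k : fieldType) (C : finite_tensor_category k).
Implicit Types X Y Z : C.

Definition ev X : hom (X^* ⊗ X) 𝟙 := dual_ev (ldualP X).
Definition coev X : hom 𝟙 (X ⊗ X^*) := dual_coev (ldualP X).

(* In strict notation, (b ⊗ id_{X^*}) ∘ (id_Y ⊗ coev_X). *)
Definition transpose Y X (b : hom (Y ⊗ X) 𝟙) : hom Y X^* :=
  lunit X^* ∘ (b ⊠ idm X^*) ∘ assocV Y X X^* ∘ (idm Y ⊠ coev X) ∘ runitV Y.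

(* In strict notation,
   (ev_Y ⊗ id_{X^*}) ∘ (id_{Y^*} ⊗ f ⊗ id_{X^*}) ∘ (id_{Y^*} ⊗ coev_X). *)
Definition dualm X Y (f : hom X Y) : hom Y^* X^* :=
  transpose (ev Y ∘ (idm Y^* ⊠ f)).

(* The canonical isomorphism, corresponding under transpose to
   ev_Y ∘ (id ⊗ ev_X ⊗ id) : Y^* ⊗ X^* ⊗ X ⊗ Y -> 1. *)
Definition dual_tens X Y : hom (Y^* ⊗ X^*) (X ⊗ Y)^* :=
  transpose (ev Y ∘ (idm Y^* ⊠ (lunit Y ∘ (ev X ⊠ idm Y) ∘ assocV X^* X Y))
             ∘ assoc Y^* X^* (X ⊗ Y)).

Definition dual_one : hom (𝟙 : C) 𝟙^* := transpose (lunit 𝟙).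

End Duals.

(* The monoidal structure of the double dual functor is
     ((dual_tens X Y)^* )^-1 ∘ dual_tens Y^* X^* : X^** ⊗ Y^** -> (X ⊗ Y)^**
     ((dual_one)^* )^-1 ∘ dual_one : 1 -> 1^**
   and pivot_tens, pivot_one say that pivot is compatible with it. *)
Record pivotal_structure (k : fieldType) (C : finite_tensor_category k) :=
  PivotalStructure {
    pivot : forall X : C, hom X (X^*)^*;
    pivot_iso : forall X, is_iso (pivot X);
    pivot_nat : forall (X Y : C) (f : hom X Y),
      pivot Y ∘ f = dualm (dualm f) ∘ pivot X;
    pivot_tens : forall X Y : C,
      dualm (dual_tens X Y) ∘ pivot (X ⊗ Y)
      = dual_tens Y^* X^* ∘ (pivot X ⊠ pivot Y);
    pivot_one : dualm (dual_one C) ∘ pivot 𝟙 = dual_one C }.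

Record algebra (k : fieldType) (C : monoidal_category k) := Algebra {
  alg_obj :> C;
  mul : hom (alg_obj ⊗ alg_obj) alg_obj;
  unit : hom 𝟙 alg_obj;
  mulA : mul ∘ (mul ⊠ idm alg_obj)
         = mul ∘ (idm alg_obj ⊠ mul) ∘ assoc alg_obj alg_obj alg_obj;
  mul_unitl : mul ∘ (unit ⊠ idm alg_obj) = lunit alg_obj;
  mul_unitr : mul ∘ (idm alg_obj ⊠ unit) = runit alg_obj }.

Record rmodule (k : fieldType) (C : monoidal_category k) (A : algebra C) :=
  RModule {
    rmod_obj :> C;
    raction : hom (rmod_obj ⊗ A) rmod_obj;
    ractionA : raction ∘ (raction ⊠ idm A)
               = raction ∘ (idm rmod_obj ⊠ mul A) ∘ assoc rmod_obj A A;
    raction_unit : raction ∘ (idm rmod_obj ⊠ unit A) = runit rmod_obj }.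

Section RModuleCategory.
Variables (k : fieldType) (C : monoidal_category k) (A : algebra C).

Definition rmod_hom_pred (M N : rmodule A) : pred (hom M N) :=
  fun f => f ∘ raction M == raction N ∘ (f ⊠ idm A).
Arguments rmod_hom_pred : clear implicits.

Lemma rmod_hom_submod M N : submod_closed (rmod_hom_pred M N).
Proof.
have lin (a : k) (f g : hom M N) : f \in rmod_hom_pred M N ->
    g \in rmod_hom_pred M N -> a *: f + g \in rmod_hom_pred M N.
  rewrite !unfold_in => /eqP hf /eqP hg; apply/eqP.
  by rewrite comp_linearl tensm_linearl comp_linearr hf hg.
split=> [|a f g]; last exact: lin.
rewrite unfold_in; apply/eqP.
rewrite (linear_at0 (comp_linearl (raction M))).
by rewrite (linear_at0 (tensm_linearl _)) (linear_at0 (comp_linearr _)).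
Qed.

HB.instance Definition _ (M N : rmodule A) := GRing.isSubmodClosed.Build k (hom M N)
  (rmod_hom_pred M N) (rmod_hom_submod M N).

Record rmod_hom (M N : rmodule A) := RModHom {
  rmod_hom_val :> hom M N;
  rmod_homP : rmod_hom_pred M N rmod_hom_val }.

HB.instance Definition _ (M N : rmodule A) := [isSub for @rmod_hom_val M N].
HB.instance Definition _ (M N : rmodule A) := [Choice of rmod_hom M N by <:].
HB.instance Definition _ (M N : rmodule A) :=
  [SubChoice_isSubLmodule of rmod_hom M N by <:].

Lemma rmod_homE M N (f : rmod_hom M N) :
  rmod_hom_val f ∘ raction M = raction N ∘ (rmod_hom_val f ⊠ idm A).
Proof. by apply/eqP; case: f. Qed.

Lemma rmod_id_subproof M : rmod_hom_pred M M (idm M).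
Proof. by rewrite /rmod_hom_pred compIm tensm_id compmI. Qed.

Lemma rmod_comp_subproof M N P (g : rmod_hom N P) (f : rmod_hom M N) :
  rmod_hom_pred M P (rmod_hom_val g ∘ rmod_hom_val f).
Proof.
rewrite /rmod_hom_pred -compA rmod_homE compA rmod_homE -compA -tensm_comp.
by rewrite compIm.
Qed.

Definition rmod_category : category k.
Proof.
unshelve refine (@Category k (rmodule A)
  (fun M N => rmod_hom M N : lmodType k)
  (fun M => RModHom (rmod_id_subproof M))
  (fun M N P g f => RModHom (rmod_comp_subproof g f)) _ _ _ _ _).
- by move=> M N f; apply/val_inj; rewrite /= compIm.
- by move=> M N f; apply/val_inj; rewrite /= compmI.
- by move=> M N P Q h g f; apply/val_inj; rewrite /= compA.
- by move=> M N P f a g h; apply/val_inj; rewrite /= comp_linearl.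
- by move=> M N P g a f h; apply/val_inj; rewrite /= comp_linearr.
Defined.

Lemma rmod_is_iso (M N : rmod_category) (f : hom M N) :
  is_iso (rmod_hom_val f) -> is_iso f.
Proof.
case=> g [gf fg].
have hg : rmod_hom_pred N M g.
  have e : (rmod_hom_val f ⊠ idm A) ∘ (g ⊠ idm A) = idm _.
    by rewrite -tensm_comp fg compIm tensm_id.
  apply/eqP; rewrite -[g ∘ _]compmI -e -compA [raction N ∘ _]compA -rmod_homE.
  by rewrite !compA gf compIm.
by exists (RModHom hg); split; apply/val_inj.
Qed.

End RModuleCategory.

Arguments rmod_hom_pred {k C A} M N _.

Record module_category (k : fieldType) (C : monoidal_category k) :=
  ModuleCategory {
    mod_category :> category k;
    lact : C -> mod_category -> mod_category;
    lactm : forall (X X' : C) (M M' : mod_category),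
      hom X X' -> hom M M' -> hom (lact X M) (lact X' M');
    lactm_id : forall X M, lactm (idm X) (idm M) = idm (lact X M);
    lactm_comp : forall X X' X'' M M' M'' (f' : hom X' X'') (f : hom X X')
        (g' : hom M' M'') (g : hom M M'),
      lactm (f' ∘ f) (g' ∘ g) = lactm f' g' ∘ lactm f g;
    lactm_linearl : forall X X' M M' (g : hom M M'),
      linear (fun f : hom X X' => lactm f g);
    lactm_linearr : forall X X' M M' (f : hom X X'),
      linear (fun g : hom M M' => lactm f g);
    lassoc : forall X Y M, hom (lact (X ⊗ Y) M) (lact X (lact Y M));
    lone : forall M, hom (lact 𝟙 M) M;
    lassoc_iso : forall X Y M, is_iso (lassoc X Y M);
    lone_iso : forall M, is_iso (lone M);
    lassoc_nat : forall X X' Y Y' M M' (f : hom X X') (g : hom Y Y')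
        (h : hom M M'),
      lassoc X' Y' M' ∘ lactm (f ⊠ g) h
      = lactm f (lactm g h) ∘ lassoc X Y M;
    lone_nat : forall M M' (f : hom M M'),
      lone M' ∘ lactm (idm 𝟙) f = f ∘ lone M;
    lpentagon : forall X Y Z M,
      lassoc X Y (lact Z M) ∘ lassoc (X ⊗ Y) Z M
      = lactm (idm X) (lassoc Y Z M) ∘ lassoc X (Y ⊗ Z) M
        ∘ lactm (assoc X Y Z) (idm M);
    ltriangle : forall X M,
      lactm (idm X) (lone M) ∘ lassoc X 𝟙 M = lactm (runit X) (idm M) }.

Arguments lassoc {k C _} X Y M.
Arguments lone {k C _} M.

Notation "X ▷ M" := (lact X M) (at level 30, right associativity) : cat_scope.
Notation "f ▶ g" := (lactm f g) (at level 30, right associativity) : cat_scope.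

Record module_functor (k : fieldType) (C : monoidal_category k)
  (M N : module_category C) := ModuleFunctor {
    modf_functor :> functor M N;
    modf_str : forall (X : C) (P : M),
      hom (modf_functor (X ▷ P)) (X ▷ modf_functor P);
    modf_str_iso : forall X P, is_iso (modf_str X P);
    modf_str_nat : forall (X X' : C) (P P' : M) (f : hom X X')
        (g : hom P P'),
      modf_str X' P' ∘ fmap modf_functor (f ▶ g)
      = (f ▶ fmap modf_functor g) ∘ modf_str X P;
    modf_str_assoc : forall X Y P,
      lassoc X Y (modf_functor P) ∘ modf_str (X ⊗ Y) P
      = (idm X ▶ modf_str Y P) ∘ modf_str X (Y ▷ P)
        ∘ fmap modf_functor (lassoc X Y P);
    modf_str_one : forall P,
      lone (modf_functor P) ∘ modf_str 𝟙 P = fmap modf_functor (lone P) }.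

Definition module_equivalent (k : fieldType) (C : monoidal_category k)
  (M N : module_category C) : Prop :=
  exists F : module_functor M N, is_equivalence F.

Section RModuleModuleCategory.
Variables (k : fieldType) (C : monoidal_category k) (A : algebra C).

Definition free_raction (X : C) (M : rmodule A) : hom ((X ⊗ M) ⊗ A) (X ⊗ M) :=
  (idm X ⊠ raction M) ∘ assoc X M A.

Lemma free_ractionA X M :
  free_raction X M ∘ (free_raction X M ⊠ idm A)
  = free_raction X M ∘ (idm (X ⊗ M) ⊠ mul A) ∘ assoc (X ⊗ M) A A.
Proof.
rewrite /free_raction tensm_compl -!compA.
rewrite [assoc X M A ∘ (_ ∘ (assoc X M A ⊠ _))]compA assoc_nat.
rewrite -(tensm_id X M) [assoc X M A ∘ (_ ∘ assoc _ _ _)]compA assoc_nat.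
rewrite !compA -!tensm_compr ractionA.
by rewrite -[in RHS]compA pentagon !tensm_compr !compA.
Qed.

Lemma free_raction_unit X M :
  free_raction X M ∘ (idm (X ⊗ M) ⊠ unit A) = runit (X ⊗ M).
Proof.
rewrite /free_raction -(tensm_id X M) -compA assoc_nat compA -tensm_compr.
by rewrite raction_unit runit_tens.
Qed.

Definition free_rmodule X M : rmodule A :=
  RModule (free_ractionA X M) (free_raction_unit X M).

Lemma free_rmod_hom_subproof X X' (M M' : rmodule A) (f : hom X X')
    (g : rmod_hom M M') :
  rmod_hom_pred (free_rmodule X M) (free_rmodule X' M')
    (f ⊠ rmod_hom_val g).
Proof.
apply/eqP; rewrite /= /free_raction compA -tensm_comp rmod_homE compmI.
by rewrite -[f in LHS]compIm tensm_comp -!compA assoc_nat.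
Qed.

Lemma assoc_rmod_hom_subproof X Y (M : rmodule A) :
  rmod_hom_pred (free_rmodule (X ⊗ Y) M) (free_rmodule X (free_rmodule Y M))
    (assoc X Y M).
Proof.
apply/eqP; rewrite /= /free_raction /= /free_raction.
rewrite -(tensm_id X Y) compA assoc_nat -compA pentagon.
by rewrite tensm_compr !compA.
Qed.

Lemma lunit_rmod_hom_subproof (M : rmodule A) :
  rmod_hom_pred (free_rmodule 𝟙 M) M (lunit M).
Proof.
apply/eqP; rewrite /= /free_raction compA lunit_nat -compA.
by rewrite lunit_tens.
Qed.

Definition rmod_module_category : module_category C.
Proof.
unshelve refine (@ModuleCategory k C (rmod_category A) free_rmodule
  (fun X X' M M' f g => RModHom (free_rmod_hom_subproof f g))
  _ _ _ _
  (fun X Y M => RModHom (assoc_rmod_hom_subproof X Y M))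
  (fun M => RModHom (lunit_rmod_hom_subproof M)) _ _ _ _ _ _).
- by move=> X M; apply/val_inj; rewrite /= tensm_id.
- by move=> X X' X'' M M' M'' f' f g' g; apply/val_inj; rewrite /= tensm_comp.
- by move=> X X' M M' g a f f'; apply/val_inj; rewrite /= tensm_linearl.
- by move=> X X' M M' f a g g'; apply/val_inj; rewrite /= tensm_linearr.
- by move=> X Y M; apply: rmod_is_iso; exists (assocV X Y M); apply: assocK.
- by move=> M; apply: rmod_is_iso; exists (lunitV M); apply: lunitK.
- by move=> X X' Y Y' M M' f g h; apply/val_inj; rewrite /= assoc_nat.
- by move=> M M' f; apply/val_inj; rewrite /= lunit_nat.
- by move=> X Y Z M; apply/val_inj; rewrite /= pentagon.
- by move=> X M; apply/val_inj; rewrite /= triangle.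
Defined.

End RModuleModuleCategory.

Definition morita_equivalent (k : fieldType) (C : monoidal_category k)
  (A B : algebra C) : Prop :=
  module_equivalent (rmod_module_category A) (rmod_module_category B).

Section Frobenius.
Variables (k : fieldType) (C : finite_tensor_category k).

(* In strict notation, (l ∘ mul ⊗ id_{A^*}) ∘ (id_A ⊗ coev_A). *)
Definition frob_map (A : algebra C) (l : hom A 𝟙) : hom A A^* :=
  transpose (l ∘ mul A).

(* The inverse of frob_map is uniquely determined; it is recorded to state
   the formula for the Nakayama isomorphism. *)
Record frobenius_form (A : algebra C) := FrobeniusForm {
  frob_form : hom A 𝟙;
  frob_mapV : hom A^* A;
  frob_mapK : inverse_pair (frob_map frob_form) frob_mapV }.

Definition nakayama (A : algebra C) (l : frobenius_form A) : hom (A^*)^* A :=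
  frob_mapV l ∘ dualm (frob_map (frob_form l)).

Definition symmetric_frobenius (p : pivotal_structure C) (A : algebra C) :
  Prop :=
  exists l : frobenius_form A, nakayama l ∘ pivot p A = idm A.

End Frobenius.

(* Main.v *)
From mathcomp Require Import all_boot all_algebra boolp.
Require Import Defs.

(* Let F be a module equivalence from right B-modules to right A-modules, let
   P := F(B), and let Q be a B-module with F(Q) isomorphic to A. Then (P, Q) is
   a Morita context, with pairings P ⊗ Q -> B and Q ⊗ P -> A, all of whose
   properties are read off after applying F. Given a symmetric Frobenius form
   lA on A, rotate the nondegenerate form Q ⊗ P -> A -> 1 by means of the
   pivotal structure into a form theta on P ⊗ Q. Symmetry of lA says that theta
   is A-balanced. Now P is the coequalizer P ⊗_A A, hence B is P ⊗_A Q in the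
   category of B-modules, and since B has a dual this remains a coequalizer
   with respect to maps into 1 in C: theta descends to a form lB on B.
   Symmetry of lB follows from compatibility of the rotation with tensor
   products, and nondegeneracy of lB from that of theta, through
   Hom(Z, B) = Hom_A(Z ⊗ P, P). *)

Set Implicit Arguments.
Unset Strict Implicit.
Unset Printing Implicit Defensive.

Local Open Scope cat_scope.

(** * Equivalences of categories and isomorphisms *)

Lemma equivalence_faithful (k : fieldType) (C D : category k)
    (F : functor C D) :
  is_equivalence F ->
  forall (X Y : C) (f g : hom X Y), fmap F f = fmap F g -> f = g.
Proof.
move=> [G [[eta [eta_iso eta_nat]] _]] X Y f g eq.
have [e [e1 e2]] := eta_iso X.
rewrite -[f]compmI -[g]compmI -e2 !compA.
by move: (eta_nat _ _ f) (eta_nat _ _ g) => /= <- <-; rewrite eq.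
Qed.

Lemma equivalence_full (k : fieldType) (C D : category k) (F : functor C D) :
  is_equivalence F ->
  forall (X Y : C) (h : hom (F X) (F Y)), exists f : hom X Y, fmap F f = h.
Proof.
move=> [G [[eta [eta_iso eta_nat]] [eps [eps_iso eps_nat]]]] X Y h.
have [e [e1 e2]] := eta_iso X.
have [e' [e1' e2']] := eta_iso Y.
have Gfaith : is_equivalence G.
  by exists F; split; [exists eps | exists eta].
(* The preimage is G h conjugated by [eta]; as G is faithful, it is enough to compare images under
   G, where naturality of [eta] applies. *)
exists (eta Y ∘ fmap G h ∘ e); apply: (equivalence_faithful Gfaith).
apply: (inverse_pair_mono (conj e1' e2')).
move: (eta_nat _ _ (eta Y ∘ fmap G h ∘ e)) => /= ->.
by rewrite -!compA e1 compmI.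
Qed.

Lemma equivalence_ess_surj (k : fieldType) (C D : category k)
    (F : functor C D) :
  is_equivalence F ->
  forall Y : D, exists (X : C) (j : hom (F X) Y) (jV : hom Y (F X)),
    inverse_pair j jV.
Proof.
move=> [G [_ [eps [eps_iso _]]]] Y.
by have [jV ?] := eps_iso Y; exists (G Y), (eps Y), jV.
Qed.

Lemma comp_iso (k : fieldType) (C : category k) (X Y Z : C) (f : hom Y Z)
  (g : hom X Y) : is_iso f -> is_iso g -> is_iso (f ∘ g).
Proof.
move=> [f' [f1 f2]] [g' [g1 g2]]; exists (g' ∘ f'); split.
  by rewrite -compA [f' ∘ _]compA f1 compIm.
by rewrite -compA [g ∘ _]compA g2 compIm.
Qed.

Lemma yoneda_iso (k : fieldType) (C : category k) (X Y : C) (f : hom X Y) :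
  (forall Z (g : hom Z Y), exists h, f ∘ h = g) -> is_mono f -> is_iso f.
Proof.
move=> surj mono; have [g fg] := surj _ (idm Y).
by exists g; split=> //; apply: mono; rewrite compA fg compIm compmI.
Qed.

(** Puts an equation in a form that rewrites inside right-nested composites. *)
Lemma comp_eq (k : fieldType) (C : category k) (X Y Z : C) (g : hom Y Z)
    (f : hom X Y) (h : hom X Z) :
  g ∘ f = h -> forall W (e : hom W X), g ∘ (f ∘ e) = h ∘ e.
Proof. by move=> <- W e; rewrite compA. Qed.

(** * Coherence identities for associators and unitors *)

Section Coherence.
Variables (k : fieldType) (C : monoidal_category k).
Implicit Types X Y Z W V U : C.

Lemma tensm_lr X X' Y Y' (f : hom X X') (g : hom Y Y') :
  f ⊠ g = (f ⊠ idm Y') ∘ (idm X ⊠ g).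
Proof. by rewrite -tensm_comp compIm compmI. Qed.

Lemma tensm_rl X X' Y Y' (f : hom X X') (g : hom Y Y') :
  f ⊠ g = (idm X' ⊠ g) ∘ (f ⊠ idm Y).
Proof. by rewrite -tensm_comp compIm compmI. Qed.

Lemma assocVK X Y Z : assoc X Y Z ∘ assocV X Y Z = idm _.
Proof. by case: (assocK X Y Z). Qed.

Lemma assocKV X Y Z : assocV X Y Z ∘ assoc X Y Z = idm _.
Proof. by case: (assocK X Y Z). Qed.

Lemma lunitKV X : lunit X ∘ lunitV X = idm _.
Proof. by case: (lunitK X). Qed.

Lemma runitKV X : runit X ∘ runitV X = idm _.
Proof. by case: (runitK X). Qed.

Lemma assocV_nat X X' Y Y' Z Z' (f : hom X X') (g : hom Y Y') (h : hom Z Z') :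
  assocV X' Y' Z' ∘ (f ⊠ g ⊠ h) = ((f ⊠ g) ⊠ h) ∘ assocV X Y Z.
Proof.
apply: (inverse_pair_mono (assocK _ _ _)).
by rewrite !compA assocVK compIm assoc_nat -compA assocVK compmI.
Qed.

Lemma runitV_nat X Y (f : hom X Y) : runitV Y ∘ f = (f ⊠ idm 𝟙) ∘ runitV X.
Proof.
apply: (inverse_pair_mono (runitK _)).
by rewrite !compA runitKV compIm runit_nat -compA runitKV compmI.
Qed.

Lemma triangleV X Y :
  assoc X 𝟙 Y ∘ (runitV X ⊠ idm Y) = idm X ⊠ lunitV Y.
Proof.
apply: (inverse_pair_mono
  (tens_inverse_pair (id_inverse_pair X) (lunitK Y))).
rewrite compA triangle -tensm_compl runitKV tensm_id.
by rewrite -tensm_compr lunitKV tensm_id.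
Qed.

Lemma runitV_tens X Y :
  assoc X Y 𝟙 ∘ runitV (X ⊗ Y) = idm X ⊠ runitV Y.
Proof.
apply: (inverse_pair_mono
  (tens_inverse_pair (id_inverse_pair X) (runitK Y))).
by rewrite compA runit_tens runitKV -tensm_compr runitKV tensm_id.
Qed.

Lemma lunit_one : lunit (𝟙 : C) = runit 𝟙.
Proof.
apply: tensm_one_id_inj; rewrite -lunit_tens -triangle.
congr (_ ∘ _); apply: (inverse_pair_mono (lunitK 𝟙)).
by rewrite lunit_nat.
Qed.

Lemma pentagonV X Y Z W :
  assocV X Y (Z ⊗ W) ∘ (idm X ⊠ assoc Y Z W) ∘ assoc X (Y ⊗ Z) W
  = assoc (X ⊗ Y) Z W ∘ (assocV X Y Z ⊠ idm W).
Proof.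
apply: (inverse_pair_epi
  (tens_inverse_pair (assocK X Y Z) (id_inverse_pair W))).
rewrite -[RHS]compA -tensm_compl assocKV tensm_id compmI.
by rewrite -!compA [(idm X ⊠ _) ∘ _]compA -pentagon compA assocKV compIm.
Qed.

(** The unit left over after contracting V ⊗ Y is absorbed into Z on one side and into W on the
    other; the triangle identifies the two. *)
Lemma contract_middle W V Y Z (b : hom (V ⊗ Y) 𝟙) :
  (idm W ⊠ (lunit Z ∘ (b ⊠ idm Z) ∘ assocV V Y Z)) ∘ assoc W V (Y ⊗ Z)
  = ((runit W ∘ (idm W ⊠ b) ∘ assoc W V Y) ⊠ idm Z) ∘ assocV (W ⊗ V) Y Z.
Proof.
apply: (inverse_pair_epi (assocK _ _ _)).
rewrite -!compA pentagon assocKV compmI !tensm_compl !tensm_compr !compA.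
rewrite -triangle -!compA; congr (_ ∘ _).
rewrite !compA assoc_nat -!compA; congr (_ ∘ _).
by rewrite !compA -tensm_compr assocKV tensm_id compIm.
Qed.

(** Both sides are a ⊗ b on U ⊗ W ⊗ V ⊗ Y, with [a] contracted first or [b] contracted first. *)
Lemma contract_outer U W V Y (a : hom (U ⊗ W) 𝟙) (b : hom (V ⊗ Y) 𝟙) :
  b ∘ ((lunit V ∘ (a ⊠ idm V) ∘ assocV U W V) ⊠ idm Y)
  = a ∘ (idm U ⊠ (runit W ∘ (idm W ⊠ b) ∘ assoc W V Y)) ∘ assoc U (W ⊗ V) Y.
Proof.
transitivity (lunit 𝟙 ∘ (a ⊠ b) ∘ assoc (U ⊗ W) V Y ∘ (assocV U W V ⊠ idm Y)).
  rewrite !tensm_compl !compA -lunit_tens [b ∘ _]compA -lunit_nat.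
  rewrite -!compA [assoc _ _ _ ∘ _]compA assoc_nat tensm_id.
  by rewrite -!compA [(_ ⊠ b) ∘ _]compA -tensm_rl.
rewrite -[LHS]compA -pentagonV !tensm_compr !compA lunit_one; congr (_ ∘ _ ∘ _).
have -> : idm U ⊠ runit W = runit (U ⊗ W) ∘ assocV U W 𝟙.
  by rewrite -runit_tens -compA assocVK compmI.
rewrite -[in RHS]compA -[in RHS](compA _ (assocV _ _ _)) assocV_nat tensm_id.
by rewrite tensm_lr !compA runit_nat.
Qed.

End Coherence.

(** * Duals, transposes and nondegenerate forms *)

Section Duals.
Variables (k : fieldType) (C : finite_tensor_category k).
Implicit Types X Y Z W : C.

Lemma ev_coevr X :
  runit X ∘ (idm X ⊠ ev X) ∘ assoc X X^* X ∘ (coev X ⊠ idm X) ∘ lunitV X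
  = idm X.
Proof. exact: dual_zigzagr. Qed.

Lemma ev_coevl X :
  lunit X^* ∘ (ev X ⊠ idm X^*) ∘ assocV X^* X X^* ∘ (idm X^* ⊠ coev X)
    ∘ runitV X^* = idm X^*.
Proof. exact: dual_zigzagl. Qed.

(** With [uncurry], the adjunction between - ⊗ Y and - ⊗ Y^*; [transpose] is the case W = 1 up to a
    unitor. *)
Definition curry X Y W (t : hom (X ⊗ Y) W) : hom X (W ⊗ Y^*) :=
  (t ⊠ idm Y^*) ∘ assocV X Y Y^* ∘ (idm X ⊠ coev Y) ∘ runitV X.

Definition uncurry X Y W (e : hom X (W ⊗ Y^*)) : hom (X ⊗ Y) W :=
  runit W ∘ (idm W ⊠ ev Y) ∘ assoc W Y^* Y ∘ (e ⊠ idm Y).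

Lemma curryK X Y W (t : hom (X ⊗ Y) W) : uncurry (curry t) = t.
Proof.
rewrite /uncurry /curry !tensm_compl !compA.
rewrite -[X in X ∘ _ ∘ _ ∘ _ = _]compA assoc_nat !compA tensm_id.
rewrite -[X in X ∘ _ ∘ _ ∘ _ ∘ _ = _]compA -tensm_rl tensm_lr !compA runit_nat.
rewrite -!compA -[RHS]compmI; congr (_ ∘ _).
rewrite -runit_tens -!compA [assoc X Y 𝟙 ∘ _]compA -tensm_id assoc_nat.
rewrite -!compA (comp_eq (pentagon _ _ _ _)) -!compA.
rewrite [(assoc X Y _ ⊠ _) ∘ _]compA -tensm_compl assocVK tensm_id compIm.
rewrite (comp_eq (assoc_nat _ _ _)) -!compA triangleV.
by rewrite -!tensm_compr -[in RHS](ev_coevr Y) !compA.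
Qed.

Lemma uncurryK X Y W (e : hom X (W ⊗ Y^*)) : curry (uncurry e) = e.
Proof.
(* By naturality in [e] it suffices to treat the identity, which is the zigzag of Y^* tensored with
   W. *)
have unit_curry : curry (uncurry (idm (W ⊗ Y^*))) = idm (W ⊗ Y^*).
  rewrite /curry /uncurry tensm_id compmI -contract_middle.
  rewrite -!compA -(tensm_id W) (comp_eq (assoc_nat _ _ _)) -!compA runitV_tens.
  by rewrite -!tensm_compr -[in RHS](ev_coevl Y) !compA.
rewrite -[RHS]compIm -unit_curry /curry /uncurry tensm_id compmI -!compA.
rewrite runitV_nat [_ ∘ (e ⊠ idm _ ∘ _)]compA -tensm_rl.
rewrite [e ⊠ coev Y]tensm_lr -(tensm_id Y) -!compA (comp_eq (assocV_nat _ _ _)).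
by rewrite -!compA [in RHS](compA (_ ⊠ _)) -tensm_compl -!compA.
Qed.

Lemma transposeE X Y (b : hom (Y ⊗ X) 𝟙) :
  transpose b = lunit _ ∘ curry b.
Proof. by rewrite /transpose /curry !compA. Qed.

Lemma ev_transpose X Y (b : hom (Y ⊗ X) 𝟙) :
  ev X ∘ (transpose b ⊠ idm X) = b.
Proof.
rewrite transposeE tensm_compl -lunit_tens !compA -lunit_nat.
by rewrite -[RHS]curryK /uncurry lunit_one.
Qed.

Lemma transpose_ev X Y (t : hom Y X^*) : transpose (ev X ∘ (t ⊠ idm X)) = t.
Proof.
have [lK lK'] := lunitK X^*.
rewrite transposeE.
suff -> : ev X ∘ (t ⊠ idm X) = uncurry (lunitV X^* ∘ t).
  by rewrite uncurryK compA lK' compIm.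
rewrite /uncurry -lunit_one lunit_nat -[ev X ∘ _ ∘ _]compA lunit_tens.
by rewrite -compA -tensm_compl compA lK' compIm.
Qed.

(** Reduces identities between maps into a dual to identities between forms. *)
Lemma ev_inj X Y (t t' : hom Y X^*) :
  ev X ∘ (t ⊠ idm X) = ev X ∘ (t' ⊠ idm X) -> t = t'.
Proof. by move=> eq; rewrite -[t]transpose_ev eq transpose_ev. Qed.

Lemma transpose_inj X Y (b b' : hom (Y ⊗ X) 𝟙) :
  transpose b = transpose b' -> b = b'.
Proof. by move=> eq; rewrite -[b]ev_transpose eq ev_transpose. Qed.

Lemma ev_dualm X Y (f : hom X Y) :
  ev X ∘ (dualm f ⊠ idm X) = ev Y ∘ (idm Y^* ⊠ f).
Proof. exact: ev_transpose. Qed.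

Lemma ev_dual_tens X Y :
  ev (X ⊗ Y) ∘ (dual_tens X Y ⊠ idm (X ⊗ Y))
  = ev Y ∘ (idm Y^* ⊠ (lunit Y ∘ (ev X ⊠ idm Y) ∘ assocV X^* X Y))
    ∘ assoc Y^* X^* (X ⊗ Y).
Proof. exact: ev_transpose. Qed.

Lemma transpose_compl X Y Z (b : hom (Y ⊗ X) 𝟙) (f : hom Z Y) :
  transpose (b ∘ (f ⊠ idm X)) = transpose b ∘ f.
Proof. by apply: ev_inj; rewrite tensm_compl compA !ev_transpose. Qed.

Lemma transpose_compr X X' Y (b : hom (Y ⊗ X) 𝟙) (g : hom X' X) :
  transpose (b ∘ (idm Y ⊠ g)) = dualm g ∘ transpose b.
Proof.
apply: ev_inj; rewrite tensm_compl compA ev_dualm ev_transpose.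
by rewrite -compA -tensm_rl [transpose b ⊠ g]tensm_lr compA ev_transpose.
Qed.

Lemma dualm_id X : dualm (idm X) = idm X^*.
Proof. by apply: ev_inj; rewrite ev_dualm. Qed.

Lemma dualm_comp X Y Z (g : hom Y Z) (f : hom X Y) :
  dualm (g ∘ f) = dualm f ∘ dualm g.
Proof.
rewrite -[X in _ = _ ∘ X]transpose_ev -transpose_compr ev_dualm.
by rewrite -compA -tensm_compr.
Qed.

Lemma dualm_iso X Y (f : hom X Y) : is_iso f -> is_iso (dualm f).
Proof.
case=> g [gf fg]; exists (dualm g).
by split; rewrite -dualm_comp ?gf ?fg dualm_id.
Qed.

Lemma nondegenerate_form X Y Z (b : hom (X ⊗ Y) 𝟙) (f : hom (Z ⊗ Y) 𝟙) :
  is_iso (transpose b) -> exists g : hom Z X, b ∘ (g ⊠ idm Y) = f.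
Proof.
move=> [c [cb bc]]; exists (c ∘ transpose f).
rewrite -{1}[b]ev_transpose -compA -tensm_compl compA bc compIm.
exact: ev_transpose.
Qed.

Lemma nondegenerate_form_inj X Y Z (b : hom (X ⊗ Y) 𝟙) (g g' : hom Z X) :
  is_iso (transpose b) -> b ∘ (g ⊠ idm Y) = b ∘ (g' ⊠ idm Y) -> g = g'.
Proof.
move=> [c biso] eq; apply: (inverse_pair_mono biso).
by rewrite -!transpose_compl eq.
Qed.

(** Through transposition, the hypotheses say that composition with [transpose b] is bijective on
    maps out of every Z; Yoneda concludes. *)
Lemma nondegenerateP X Y (b : hom (X ⊗ Y) 𝟙) :
  (forall Z (f : hom (Z ⊗ Y) 𝟙), exists g : hom Z X, b ∘ (g ⊠ idm Y) = f) ->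
  (forall Z (g g' : hom Z X),
    b ∘ (g ⊠ idm Y) = b ∘ (g' ⊠ idm Y) -> g = g') ->
  is_iso (transpose b).
Proof.
move=> surj inj; apply: yoneda_iso => [Z t|Z g g' eq].
  have [g eq] := surj Z (ev Y ∘ (t ⊠ idm Y)).
  by exists g; rewrite -transpose_compl eq transpose_ev.
by apply: inj; apply: transpose_inj; rewrite !transpose_compl.
Qed.

(** * Rotation of forms by the pivotal structure *)

Section Rotation.
Variable p : pivotal_structure C.

(** For vector spaces with the usual pivotal structure, this is (y, x) |-> b(x, y). *)
Definition rotate X Y (b : hom (X ⊗ Y) 𝟙) : hom (Y ⊗ X) 𝟙 :=
  ev Y^* ∘ (pivot p Y ⊠ transpose b).

Lemma rotate_nat X X' Y Y' (b : hom (X ⊗ Y) 𝟙) (f : hom X' X) (g : hom Y' Y) :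
  rotate (b ∘ (f ⊠ g)) = rotate b ∘ (g ⊠ f).
Proof.
rewrite /rotate [f ⊠ g]tensm_rl compA transpose_compl transpose_compr.
rewrite -[RHS]compA -tensm_comp pivot_nat.
rewrite -[pivot p Y' in LHS]compIm -[transpose b ∘ f as X in (_ ⊠ X)]compIm.
by rewrite -[_ ∘ f in LHS]compA !tensm_comp !compA ev_dualm.
Qed.

Lemma transpose_rotate X Y (b : hom (X ⊗ Y) 𝟙) :
  transpose (rotate b) = dualm (transpose b) ∘ pivot p Y.
Proof.
apply: ev_inj; rewrite ev_transpose tensm_compl compA ev_dualm -compA.
by rewrite -tensm_rl.
Qed.

Lemma rotate_nondegenerate X Y (b : hom (X ⊗ Y) 𝟙) :
  is_iso (transpose b) -> is_iso (transpose (rotate b)).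
Proof.
move=> biso; rewrite transpose_rotate; apply: comp_iso; last exact: pivot_iso.
exact: dualm_iso.
Qed.

(** Rotating past Y ⊗ Z at once amounts to rotating past Z and then past Y. Monoidality of the
    pivotal structure enters here. *)
Lemma rotate_tens X Y Z (b : hom (X ⊗ Y ⊗ Z) 𝟙) :
  rotate b
  = rotate (rotate (b ∘ assoc X Y Z) ∘ assoc Z X Y) ∘ assoc Y Z X.
Proof.
(* The map [e] from X to Z^* ⊗ Y^* curries the last two arguments of [b] one at a time; [dual_tens]
   turns it into [transpose b]. *)
set c := b ∘ assoc X Y Z; pose e := curry (transpose c).
have e1 : uncurry e = transpose c by apply: curryK.
have be : transpose b = dual_tens Y Z ∘ e.
  apply: ev_inj; rewrite ev_transpose tensm_compl compA ev_dual_tens.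
  rewrite -[ev Z ∘ _ ∘ assoc _ _ _]compA contract_middle -!compA.
  rewrite -(tensm_id Y) assocV_nat [(_ ⊠ idm Z) ∘ _]compA -tensm_compl.
  by rewrite !compA -/(uncurry e) e1 ev_transpose -compA assocVK compmI.
rewrite /rotate be.
have -> : transpose (ev Z^* ∘ (pivot p Z ⊠ transpose c) ∘ assoc Z X Y)
  = lunit Y^* ∘ (ev Z^* ⊠ idm Y^*) ∘ assocV _ _ _ ∘ (pivot p Z ⊠ e).
  apply: ev_inj; rewrite ev_transpose tensm_compl compA contract_outer.
  rewrite -!compA assoc_nat !compA; congr (_ ∘ _).
  by rewrite -[RHS]compA -tensm_comp compIm -e1.
(* Moving [dual_tens] to the other side of the evaluation dualizes it, which is the form in which
   [pivot_tens] applies. *)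
rewrite -[pivot p (Y ⊗ Z)]compIm tensm_comp compA -ev_dualm -compA.
rewrite -tensm_comp pivot_tens.
rewrite tensm_comp compA ev_dual_tens -!compA assoc_nat compA.
by rewrite !compA -[ev _ ∘ _ ∘ _]compA -tensm_comp compIm.
Qed.

End Rotation.
End Duals.

(** * Module maps, free modules and balanced maps *)

Section ModuleMaps.
Variables (k : fieldType) (C : monoidal_category k) (A : algebra C).

Definition rmod_comp (M N P : rmodule A) (g : rmod_hom N P) (f : rmod_hom M N) :
  rmod_hom M P := RModHom (rmod_comp_subproof g f).

Definition free_map X X' (M M' : rmodule A) (f : hom X X') (g : rmod_hom M M') :
  rmod_hom (free_rmodule X M) (free_rmodule X' M') :=
  RModHom (free_rmod_hom_subproof f g).

Definition free_assoc X Y (M : rmodule A) :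
  rmod_hom (free_rmodule (X ⊗ Y) M) (free_rmodule X (free_rmodule Y M)) :=
  RModHom (assoc_rmod_hom_subproof X Y M).

Definition rmod_idm (M : rmodule A) : rmod_hom M M :=
  RModHom (rmod_id_subproof M).

Definition regular_rmodule : rmodule A := RModule (mulA A) (mul_unitr A).

Lemma raction_linear (M : rmodule A) :
  rmod_hom_pred (free_rmodule M regular_rmodule) M (raction M).
Proof. by apply/eqP; rewrite /= /free_raction /= compA ractionA. Qed.

Definition raction_map (M : rmodule A) :
    rmod_hom (free_rmodule M regular_rmodule) M :=
  RModHom (raction_linear M).

(** X ⊗ A is the free module on X, so a linear map out of it is recovered from its restriction along
    the unit. *)
Lemma linear_regularE X (M : rmodule A)
    (f : rmod_hom (free_rmodule X regular_rmodule) M) :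
  rmod_hom_val f
  = raction M ∘ ((rmod_hom_val f ∘ (idm X ⊠ unit A) ∘ runitV X) ⊠ idm A).
Proof.
rewrite 2!tensm_compl 2!compA -[raction M ∘ _]rmod_homE /= /free_raction.
rewrite -!compA (comp_eq (assoc_nat _ _ _)) -compA triangleV.
rewrite [(_ ⊠ mul A) ∘ _]compA -!tensm_compr mul_unitl lunitKV tensm_id.
by rewrite compmI.
Qed.

Lemma raction_extend X (M : rmodule A) (f : hom X M) :
  rmod_hom_pred (free_rmodule X regular_rmodule) M (raction M ∘ (f ⊠ idm A)).
Proof.
apply/eqP; rewrite /= /free_raction /= tensm_compl !compA ractionA -!compA.
by rewrite assoc_nat tensm_id !compA -![_ ∘ _ ∘ (f ⊠ _)]compA -tensm_rl
  -![_ ∘ _ ∘ (_ ⊠ mul A)]compA -tensm_lr.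
Qed.

(* [raction M] exhibits M as the coequalizer M ⊗_A A. *)
Lemma balanced_factor (M N : rmodule A)
    (y : rmod_hom (free_rmodule M regular_rmodule) N) :
  rmod_hom_val y ∘ (raction M ⊠ idm A)
  = rmod_hom_val y ∘ (idm (rmod_obj M) ⊠ mul A) ∘ assoc M A A ->
  exists g : rmod_hom M N, rmod_hom_val g ∘ raction M = y.
Proof.
(* In elements g(m) = y(m ⊗ 1), and balancedness gives g(m a) = y(m a ⊗ 1) = y(m ⊗ a). *)
move=> y_bal; set g := rmod_hom_val y ∘ (idm (rmod_obj M) ⊠ unit A) ∘ runitV M.
have gE : g ∘ raction M = y.
  rewrite /g -!compA runitV_nat [(_ ⊠ unit A) ∘ _]compA -tensm_rl.
  rewrite [raction M ⊠ _]tensm_lr -compA (comp_eq y_bal).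
  rewrite -(tensm_id (rmod_obj M)) -!compA (comp_eq (assoc_nat _ _ _)) -compA.
  rewrite runitV_tens [(_ ⊠ mul A) ∘ _]compA -!tensm_compr mul_unitr runitKV.
  by rewrite tensm_id compmI.
have g_lin : rmod_hom_pred M N g by apply/eqP; rewrite gE linear_regularE.
by exists (RModHom g_lin).
Qed.

End ModuleMaps.

(** Composing the symmetry condition with [frob_map l] turns it into an equation of transposes,
    since the rotated form has transpose [dualm (frob_map l) ∘ pivot p A]. *)
Lemma symmetric_frobeniusP (k : fieldType) (C : finite_tensor_category k)
    (p : pivotal_structure C) (A : algebra C) :
  symmetric_frobenius p A <->
  exists l : hom A 𝟙, is_iso (frob_map l) /\ rotate p (l ∘ mul A) = l ∘ mul A.
Proof.
split=> [[[l v lv] /= sym]|[l [[v lv] sym]]].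
  exists l; split; first by exists v.
  apply: transpose_inj; rewrite transpose_rotate -/(frob_map l).
  by rewrite -[RHS]compmI -sym /nakayama /= !compA (proj2 lv) compIm.
exists (FrobeniusForm lv); rewrite /nakayama /= -compA.
by rewrite -transpose_rotate sym; case: lv.
Qed.

(** * The coinduced module A^* and Frobenius forms *)

Section RightModules.
Variables (k : fieldType) (C : finite_tensor_category k) (A : algebra C).

(** In elements, (phi a)(b) = phi(a b). *)
Definition dual_raction : hom (A^* ⊗ A) A^* :=
  transpose (ev A ∘ (idm A^* ⊠ mul A) ∘ assoc A^* A A).

Lemma ev_dual_raction :
  ev A ∘ (dual_raction ⊠ idm A) = ev A ∘ (idm A^* ⊠ mul A) ∘ assoc A^* A A.
Proof. exact: ev_transpose. Qed.

Lemma dual_ractionA :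
  dual_raction ∘ (dual_raction ⊠ idm A)
  = dual_raction ∘ (idm A^* ⊠ mul A) ∘ assoc A^* A A.
Proof.
move: dual_raction ev_dual_raction => r rE.
apply: ev_inj; rewrite !tensm_compl !compA rE.
rewrite -[LHS]compA assoc_nat tensm_id compA -[in LHS](compA (ev A)) -tensm_rl.
rewrite [r ⊠ mul A]tensm_lr.
rewrite compA rE.
rewrite -!compA (comp_eq (assoc_nat _ _ _)) -[idm (_ ⊗ _)]tensm_id.
rewrite (comp_eq (assoc_nat _ _ _)) -!compA pentagon.
by congr (_ ∘ _); rewrite !compA -!tensm_compr mulA.
Qed.

Lemma dual_raction_unit : dual_raction ∘ (idm A^* ⊠ unit A) = runit A^*.
Proof.
move: dual_raction ev_dual_raction => r rE.
apply: ev_inj; rewrite tensm_compl compA rE -!compA assoc_nat.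
by rewrite [(_ ⊠ mul A) ∘ _]compA -tensm_compr mul_unitl triangle.
Qed.

Definition dual_rmodule : rmodule A := RModule dual_ractionA dual_raction_unit.

Lemma coextend_subproof (M : rmodule A) (f : hom M 𝟙) :
  rmod_hom_pred M dual_rmodule (transpose (f ∘ raction M)).
Proof.
apply/eqP; apply: ev_inj => /=.
move: (transpose _) (ev_transpose (f ∘ raction M)) => t tE.
move: dual_raction ev_dual_raction => r rE.
rewrite !tensm_compl !compA tE rE -!compA assoc_nat tensm_id.
rewrite [(_ ⊠ mul A) ∘ _]compA -tensm_rl [t ⊠ mul A]tensm_lr !compA tE.
by rewrite -[LHS]compA ractionA !compA.
Qed.

(* In terms of elements, m is sent to the functional a |-> f (m a): A^* is the
   module coinduced from 1. *)
Definition coextend (M : rmodule A) (f : hom M 𝟙) : rmod_hom M dual_rmodule :=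
  RModHom (coextend_subproof f).

Definition eval_unit X (g : hom X A^*) : hom X 𝟙 :=
  ev A ∘ (g ⊠ unit A) ∘ runitV X.

Lemma eval_unit_comp X Y (g : hom Y A^*) (f : hom X Y) :
  eval_unit (g ∘ f) = eval_unit g ∘ f.
Proof.
rewrite /eval_unit -!compA runitV_nat [in RHS](compA (_ ⊠ _)).
by rewrite -tensm_comp compmI.
Qed.

Lemma eval_unit_coextend M (f : hom (rmod_obj M) 𝟙) :
  eval_unit (coextend f) = f.
Proof.
rewrite /eval_unit /= tensm_lr !compA ev_transpose -[_ ∘ raction M ∘ _]compA.
by rewrite raction_unit -compA runitKV compmI.
Qed.

Lemma coextend_comp (M N : rmodule A) (g : rmod_hom M N) (f : hom N 𝟙) :
  rmod_hom_val (coextend (f ∘ g)) = rmod_hom_val (coextend f) ∘ g.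
Proof. by rewrite /= -compA rmod_homE compA transpose_compl. Qed.

Section FrobeniusFactorization.
Variable l : hom A 𝟙.
Hypothesis l_iso : is_iso (frob_map l).

(** Coextending [l] gives [frob_map l], here an isomorphism of modules from A to A^*, so A inherits
    the universal property of the coinduced module. *)
Lemma frobenius_factor (M : rmodule A) (f : hom M 𝟙) :
  exists g : rmod_hom M (regular_rmodule A), l ∘ g = f.
Proof.
pose phi : @hom _ (rmod_category A) (regular_rmodule A) dual_rmodule :=
  @coextend (regular_rmodule A) l.
have [v [v1 v2]] : is_iso phi by apply: rmod_is_iso.
exists (v ∘ coextend f : @hom _ (rmod_category A) M (regular_rmodule A)).
rewrite -[RHS]eval_unit_coextend.
rewrite -[l in LHS](@eval_unit_coextend (regular_rmodule A)).
rewrite -eval_unit_comp /= compA.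
by move/(congr1 (@rmod_hom_val _ _ _ _ _)): v2 => /= ->; rewrite compIm.
Qed.

Lemma frobenius_factor_inj (M : rmodule A)
    (g g' : rmod_hom M (regular_rmodule A)) :
  l ∘ g = l ∘ g' -> rmod_hom_val g = g'.
Proof.
case: l_iso => v lv eq; apply: (inverse_pair_mono lv).
apply: etrans (esym (coextend_comp g l)) (etrans _ (coextend_comp g' l)).
by rewrite eq.
Qed.

End FrobeniusFactorization.
End RightModules.

(** * Module functors and the comparison map N ⊗ P -> F(N) *)

Section ModuleEquivalence.
Variables (k : fieldType) (C : monoidal_category k) (A B : algebra C).
Variable F : module_functor (rmod_module_category B) (rmod_module_category A).

(** The data of F are restated through [rmodule] and [rmod_hom], so that their underlying morphisms
    compose in C. *)
Definition mfobj (N : rmodule B) : rmodule A := F N.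

Definition mfmap N N' (f : rmod_hom N N') : rmod_hom (mfobj N) (mfobj N') :=
  fmap F (f : @hom _ (rmod_module_category B) N N').

Definition mfstr X N :
    rmod_hom (mfobj (free_rmodule X N)) (free_rmodule X (mfobj N)) :=
  modf_str F X N.

Definition mfstrV X N :
    rmod_hom (free_rmodule X (mfobj N)) (mfobj (free_rmodule X N)) :=
  projT1 (cid (modf_str_iso F X N)).

Lemma mfstrK X N : inverse_pair (rmod_hom_val (mfstr X N)) (mfstrV X N).
Proof.
by rewrite /mfstrV; case: cid => s /= [/(congr1 (@rmod_hom_val _ _ _ _ _)) s1
  /(congr1 (@rmod_hom_val _ _ _ _ _)) s2].
Qed.

Lemma mfmap_eq N N' (f g : rmod_hom N N') :
  rmod_hom_val f = g -> rmod_hom_val (mfmap f) = mfmap g.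
Proof. by move=> /val_inj ->. Qed.

Lemma mfmap_id N : rmod_hom_val (mfmap (rmod_idm N)) = idm (rmod_obj (mfobj N)).
Proof. exact: (congr1 (@rmod_hom_val _ _ _ _ _) (fmap_id F _)). Qed.

Lemma mfmap_comp N1 N2 N3 (g : rmod_hom N2 N3) (f : rmod_hom N1 N2) :
  rmod_hom_val (mfmap (rmod_comp g f)) = rmod_hom_val (mfmap g) ∘ mfmap f.
Proof. exact: (congr1 (@rmod_hom_val _ _ _ _ _) (fmap_comp F _ _)). Qed.

Lemma mfstrV_nat X X' N N' (f : hom X X') (g : rmod_hom N N') :
  rmod_hom_val (mfmap (free_map f g)) ∘ mfstrV X N
  = rmod_hom_val (mfstrV X' N') ∘ (f ⊠ rmod_hom_val (mfmap g)).
Proof.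
apply: (inverse_pair_mono (mfstrK _ _)).
rewrite !compA (proj2 (mfstrK _ _)) compIm.
have /(congr1 (@rmod_hom_val _ _ _ _ _)) /= e := modf_str_nat F f
  (g : @hom _ (rmod_module_category B) N N').
apply: etrans (congr1 (fun h => h ∘ _) e) _.
by rewrite -compA (proj2 (mfstrK _ _)) compmI.
Qed.

Lemma mfstrV_assoc X Y N :
  rmod_hom_val (mfmap (free_assoc X Y N)) ∘ mfstrV (X ⊗ Y) N
  = rmod_hom_val (mfstrV X (free_rmodule Y N)) ∘ (idm X ⊠ mfstrV Y N)
    ∘ assoc X Y (mfobj N).
Proof.
apply: (inverse_pair_mono (mfstrK _ _)).
rewrite !compA (proj2 (mfstrK _ _)) compIm.
apply: (inverse_pair_mono
  (tens_inverse_pair (id_inverse_pair X) (mfstrK Y N))).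
rewrite !compA -tensm_compr (proj2 (mfstrK _ _)) tensm_id compIm.
have /(congr1 (@rmod_hom_val _ _ _ _ _)) /= e := modf_str_assoc F X Y N.
apply: etrans (congr1 (fun h => h ∘ _) (esym e)) _.
by rewrite -compA (proj2 (mfstrK _ _)) compmI.
Qed.

Notation P := (mfobj (regular_rmodule B)).

(** The image under F of the action N ⊗ B -> N. For N = B it is the left action of B on P; in
    general it plays the role of the canonical map from N ⊗_B P to F(N), being balanced by
    [tau_raction]. *)
Definition tau (N : rmodule B) : rmod_hom (free_rmodule N P) (mfobj N) :=
  rmod_comp (mfmap (raction_map N)) (mfstrV N (regular_rmodule B)).

Lemma tau_nat N N' (g : rmod_hom N N') :
  rmod_hom_val (mfmap g) ∘ tau N
  = rmod_hom_val (tau N') ∘ (rmod_hom_val g ⊠ idm P).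
Proof.
rewrite /= compA -mfmap_comp.
have -> : rmod_hom_val (mfmap (rmod_comp g (raction_map N)))
  = rmod_hom_val (mfmap (raction_map N'))
    ∘ mfmap (free_map (rmod_hom_val g) (rmod_idm (regular_rmodule B))).
  by rewrite -mfmap_comp; apply: mfmap_eq; rewrite /= rmod_homE.
by rewrite -!compA mfstrV_nat mfmap_id.
Qed.

Lemma tau_free X N :
  rmod_hom_val (tau (free_rmodule X N))
  = rmod_hom_val (mfstrV X N) ∘ (idm X ⊠ tau N) ∘ assoc X N P.
Proof.
rewrite /= (@mfmap_eq _ _ _
  (rmod_comp (free_map (idm X) (raction_map N)) (free_assoc X N _))) //.
rewrite mfmap_comp -compA mfstrV_assoc !compA mfstrV_nat.
by rewrite tensm_compr !compA.
Qed.

(** Naturality of [tau] at the module map N ⊗ B -> N. *)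
Lemma tau_raction N :
  rmod_hom_val (tau N) ∘ (raction N ⊠ idm P)
  = rmod_hom_val (tau N) ∘ (idm (rmod_obj N) ⊠ tau (regular_rmodule B))
    ∘ assoc N B P.
Proof. by rewrite -(tau_nat (raction_map N)) tau_free !compA. Qed.

Lemma mfmap_strV_tau X N (f : rmod_hom (free_rmodule X (regular_rmodule B)) N) :
  rmod_hom_val (mfmap f) ∘ mfstrV X (regular_rmodule B)
  = rmod_hom_val (tau N)
    ∘ ((rmod_hom_val f ∘ (idm X ⊠ unit B) ∘ runitV X) ⊠ idm P).
Proof.
set b := _ ∘ runitV X.
have -> : rmod_hom_val (mfmap f) = rmod_hom_val (mfmap (raction_map N))
  ∘ mfmap (free_map b (rmod_idm (regular_rmodule B))).
  by rewrite -mfmap_comp; apply: mfmap_eq; rewrite linear_regularE.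
by rewrite -[LHS]compA mfstrV_nat mfmap_id [in RHS]/= -[RHS]compA.
Qed.

Hypothesis F_equiv : is_equivalence F.

Lemma mfmap_inj N N' (f g : rmod_hom N N') :
  rmod_hom_val (mfmap f) = mfmap g -> rmod_hom_val f = g.
Proof. by move=> /val_inj /(equivalence_faithful F_equiv) ->. Qed.

Lemma mfmap_full N N' (h : rmod_hom (mfobj N) (mfobj N')) :
  exists f : rmod_hom N N', mfmap f = h.
Proof. by have [f <-] := equivalence_full F_equiv h; exists f. Qed.

(** Hom(X, N) is Hom_B(X ⊗ B, N) by freeness, then Hom_A(F(X ⊗ B), F(N)) by fullness, then Hom_A(X ⊗
    P, F(N)) by the module structure of F. Faithfulness gives [tau_inj]. *)
Lemma tau_universal X N (h : rmod_hom (free_rmodule X P) (mfobj N)) :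
  exists b : hom X N, rmod_hom_val (tau N) ∘ (b ⊠ idm P) = h.
Proof.
have [f fh] := mfmap_full (rmod_comp h (mfstr X (regular_rmodule B))).
exists (rmod_hom_val f ∘ (idm X ⊠ unit B) ∘ runitV X).
rewrite -mfmap_strV_tau fh /= -compA.
by rewrite (proj2 (mfstrK _ _)) compmI.
Qed.

Lemma tau_inj X N (b b' : hom X (rmod_obj N)) :
  rmod_hom_val (tau N) ∘ (b ⊠ idm P) = rmod_hom_val (tau N) ∘ (b' ⊠ idm P) ->
  b = b'.
Proof.
have unit_extend (c : hom X N) :
    raction N ∘ (c ⊠ idm B) ∘ (idm X ⊠ unit B) ∘ runitV X = c.
  rewrite -[raction N ∘ _ ∘ _]compA -tensm_lr tensm_rl compA raction_unit.
  by rewrite -compA -runitV_nat compA runitKV compIm.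
move=> eq; rewrite -[b]unit_extend -[b']unit_extend.
congr (_ ∘ _ ∘ _).
apply: (@mfmap_inj _ _
  (RModHom (raction_extend b)) (RModHom (raction_extend b'))).
have [s1 s2] := mfstrK X (regular_rmodule B).
apply: (inverse_pair_epi (conj s2 s1)).
by rewrite !mfmap_strV_tau /= !unit_extend.
Qed.

End ModuleEquivalence.

(** * The Morita context (P, Q) *)

Section MoritaContext.
Variables (k : fieldType) (C : finite_tensor_category k) (A B : algebra C).
Variable F : module_functor (rmod_module_category B) (rmod_module_category A).
Hypothesis F_equiv : is_equivalence F.

Notation RA := (regular_rmodule A).
Notation RB := (regular_rmodule B).
Notation P := (mfobj F RB).
Notation actB := (rmod_hom_val (tau F RB)).

Variables (Q : rmodule B) (j : rmod_hom (mfobj F Q) RA)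
  (jV : rmod_hom RA (mfobj F Q)).
Hypothesis jK : inverse_pair (rmod_hom_val j) jV.

(** With F(Q) identified with A through [j], the image of [pairB] under F is the action of A on P,
    and that of [actA] is the multiplication of A. *)
Variable pairB : rmod_hom (free_rmodule P Q) RB.
Hypothesis pairBE : rmod_hom_val (mfmap F pairB) ∘ mfstrV F P Q
  = raction P ∘ (idm (rmod_obj P) ⊠ j).

Variable actA : rmod_hom (free_rmodule A Q) Q.
Hypothesis actAE : rmod_hom_val (mfmap F actA) ∘ mfstrV F A Q
  = rmod_hom_val jV ∘ mul A ∘ (idm (alg_obj A) ⊠ j).

Definition pairA : rmod_hom (free_rmodule Q P) RA := rmod_comp j (tau F Q).

Lemma pairAE : rmod_hom_val pairA = rmod_hom_val j ∘ tau F Q.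
Proof. by []. Qed.

Lemma mfmap_strV_inj X N N' (f g : rmod_hom (free_rmodule X N) N') :
  rmod_hom_val (mfmap F f) ∘ mfstrV F X N
  = rmod_hom_val (mfmap F g) ∘ mfstrV F X N ->
  rmod_hom_val f = g.
Proof.
have [s1 s2] := mfstrK F X N.
move=> eq; apply: (mfmap_inj F_equiv).
exact: (inverse_pair_epi (conj s2 s1)).
Qed.

(** After F, this says that the actions of B and A on P commute, which is A-linearity of
    [tau F RB]. *)
Lemma pairB_linear_left :
  mul B ∘ (idm (alg_obj B) ⊠ pairB) ∘ assoc B P Q
  = rmod_hom_val pairB ∘ (actB ⊠ idm (rmod_obj Q)).
Proof.
apply: (@mfmap_strV_inj _ _ _
  (rmod_comp (rmod_comp (raction_map RB) (free_map (idm (alg_obj B)) pairB))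
     (free_assoc B P Q))
  (rmod_comp pairB (free_map actB (rmod_idm Q)))).
rewrite !mfmap_comp -!compA mfstrV_assoc !mfstrV_nat.
rewrite -!compA (comp_eq (mfstrV_nat _ _ _)) mfmap_id.
rewrite (comp_eq pairBE) -[RHS]compA -tensm_rl [in RHS]tensm_lr.
rewrite [RHS]compA -(rmod_homE (tau F RB)) /= /free_raction.
rewrite -!compA -tensm_id assoc_nat.
rewrite [(_ ⊠ mfmap F pairB) ∘ _]compA -tensm_compr pairBE tensm_compr.
by rewrite !compA.
Qed.

Lemma pairA_linear_left :
  rmod_hom_val pairA ∘ (rmod_hom_val actA ⊠ idm (rmod_obj P))
  = mul A ∘ (idm (alg_obj A) ⊠ pairA) ∘ assoc A Q P.
Proof.
rewrite pairAE tensm_compr -[LHS]compA -tau_nat tau_free !compA.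
rewrite -[_ ∘ rmod_hom_val (mfmap F actA) ∘ _]compA actAE.
by rewrite !compA (proj2 jK) compIm.
Qed.

Lemma pairA_balanced :
  rmod_hom_val pairA ∘ (raction Q ⊠ idm (rmod_obj P))
  = rmod_hom_val pairA ∘ (idm (rmod_obj Q) ⊠ actB) ∘ assoc Q B P.
Proof. by rewrite pairAE -[LHS]compA tau_raction !compA. Qed.

Lemma pairA_linear_right :
  rmod_hom_val pairA ∘ (idm (rmod_obj Q) ⊠ raction P) ∘ assoc Q P A
  = mul A ∘ (rmod_hom_val pairA ⊠ idm (alg_obj A)).
Proof. by rewrite -[LHS]compA; apply: (rmod_homE pairA). Qed.

Lemma pairB_linear_right :
  rmod_hom_val pairB ∘ (idm (rmod_obj P) ⊠ raction Q) ∘ assoc P Q B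
  = mul B ∘ (rmod_hom_val pairB ⊠ idm (alg_obj B)).
Proof. by rewrite -[LHS]compA; apply: (rmod_homE pairB). Qed.

(** After F, this becomes associativity of the action of A on P. *)
Lemma pairB_balanced :
  rmod_hom_val pairB ∘ (raction P ⊠ idm (rmod_obj Q))
  = rmod_hom_val pairB ∘ (idm (rmod_obj P) ⊠ actA) ∘ assoc P A Q.
Proof.
apply: (@mfmap_strV_inj _ _ _
  (rmod_comp pairB (free_map (raction P) (rmod_idm Q)))
  (rmod_comp (rmod_comp pairB (free_map (idm (rmod_obj P)) actA))
     (free_assoc P A Q))).
rewrite !mfmap_comp -!compA mfstrV_assoc mfstrV_nat mfmap_id.
rewrite -!compA (comp_eq (mfstrV_nat _ _ _)) -!compA !(comp_eq pairBE) -!compA.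
rewrite -tensm_rl [raction P ⊠ rmod_hom_val j]tensm_lr [LHS]compA.
rewrite (ractionA P).
rewrite [(_ ⊠ mfmap F actA) ∘ _]compA -tensm_compr actAE.
rewrite [(_ ⊠ j) ∘ _]compA -tensm_compr !compA (proj2 jK) compIm.
by rewrite tensm_compr -(tensm_id (rmod_obj P)) -!compA assoc_nat.
Qed.

Lemma pairA_universal X (h : rmod_hom (free_rmodule X P) RA) :
  exists g : hom X Q, rmod_hom_val pairA ∘ (g ⊠ idm (rmod_obj P)) = h.
Proof.
have [g gE] := tau_universal F_equiv (rmod_comp jV h).
by exists g; rewrite pairAE -[LHS]compA gE /= compA (proj2 jK) compIm.
Qed.

Lemma pairA_inj X (g g' : hom X Q) :
  rmod_hom_val pairA ∘ (g ⊠ idm (rmod_obj P))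
  = rmod_hom_val pairA ∘ (g' ⊠ idm (rmod_obj P)) -> g = g'.
Proof.
rewrite pairAE -2!compA => /(inverse_pair_mono jK); exact: tau_inj.
Qed.

(** Functionals are not in the domain of F, so [h] is first coextended to a module map into B^*. Its
    image under F is a balanced map on P ⊗ A, hence factors through P = F(B), and fullness brings
    the factor back to B. *)
Lemma pairB_factor (h : hom (P ⊗ Q) 𝟙) :
  h ∘ (raction P ⊠ idm (rmod_obj Q))
  = h ∘ (idm (rmod_obj P) ⊠ actA) ∘ assoc P A Q ->
  exists l : hom B 𝟙, l ∘ pairB = h.
Proof.
move=> h_bal; pose H := @coextend _ _ B (free_rmodule P Q) h.
have H_bal : rmod_hom_val (mfmap F H) ∘ mfstrV F P Q
    ∘ (raction P ⊠ idm (rmod_obj (mfobj F Q)))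
  = rmod_hom_val (mfmap F H) ∘ mfstrV F P Q
    ∘ (idm (rmod_obj P) ⊠ (rmod_hom_val jV ∘ mul A ∘ (idm (alg_obj A) ⊠ j)))
    ∘ assoc P A (mfobj F Q).
  rewrite -[X in _ ⊠ X]mfmap_id -actAE -!compA -(mfstrV_nat F).
  rewrite tensm_compr -!compA (comp_eq (esym (mfstrV_nat F _ _))) -!compA.
  rewrite [mfstrV F P _ ∘ _]compA -mfstrV_assoc !compA -!mfmap_comp.
  congr (_ ∘ _); apply: mfmap_eq.
  apply: etrans (esym (coextend_comp (free_map (raction P) (rmod_idm Q)) h)) _.
  apply: etrans _ (compA _ _ _); apply: etrans _ (coextend_comp
    (rmod_comp (free_map (idm (rmod_obj P)) actA) (free_assoc P A Q)) h).
  by congr (rmod_hom_val (coextend _)); rewrite /= h_bal compA.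
pose y := rmod_comp (rmod_comp (mfmap F H) (mfstrV F P Q))
  (free_map (idm (rmod_obj P)) jV).
have [|g gE] := @balanced_factor _ _ _ P _ y.
  rewrite /= -[LHS]compA -tensm_rl [raction P ⊠ _]tensm_lr compA H_bal.
  rewrite -(tensm_id (rmod_obj P)) -!compA assoc_nat.
  rewrite [(_ ⊠ (rmod_hom_val jV ∘ _)) ∘ _]compA -tensm_compr -!compA.
  rewrite -tensm_compr (proj2 jK) tensm_id compmI.
  by rewrite [(_ ⊠ jV) ∘ _]compA -tensm_compr.
(* A module map from B to B^* is obtained; evaluating its values at the unit of B gives the
   functional. *)
have [g0 g0E] := mfmap_full F_equiv g.
exists (eval_unit (rmod_hom_val g0)); rewrite -eval_unit_comp.
rewrite -[RHS](@eval_unit_coextend _ _ B (free_rmodule P Q)).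
congr (eval_unit _).
apply: (@mfmap_strV_inj _ _ _ (rmod_comp g0 pairB)).
rewrite mfmap_comp -compA pairBE compA g0E gE /= -compA -tensm_compr.
by rewrite (proj1 jK) tensm_id compmI.
Qed.

(** The image of [pairB] under F has a section [r] in C, p |-> p ⊗ 1 in P ⊗ A. Coextension makes the
    functionals into module maps, to which F and then [r] can be applied. *)
Lemma pairB_epi Z (f f' : hom (Z ⊗ B) 𝟙) :
  f ∘ (idm Z ⊠ pairB) = f' ∘ (idm Z ⊠ pairB) -> f = f'.
Proof.
pose r := rmod_hom_val (mfstrV F P Q) ∘ (idm (rmod_obj P) ⊠ jV)
  ∘ (idm (rmod_obj P) ⊠ unit A) ∘ runitV P.
have rE : rmod_hom_val (mfmap F pairB) ∘ r = idm (rmod_obj P).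
  rewrite /r !compA pairBE -[raction P ∘ _ ∘ _]compA -tensm_compr (proj2 jK).
  by rewrite tensm_id compmI raction_unit runitKV.
pose H h := @coextend _ _ B (free_rmodule Z RB) h.
have factor h : rmod_hom_val (mfmap F (H h)) ∘ mfstrV F Z RB
    = rmod_hom_val (mfmap F (@coextend _ _ B
        (free_rmodule Z (free_rmodule P Q)) (h ∘ (idm Z ⊠ pairB))))
      ∘ mfstrV F Z (free_rmodule P Q) ∘ (idm Z ⊠ r).
  rewrite (@mfmap_eq _ _ _ _ _ _ _ _
    (rmod_comp (H h) (free_map (idm Z) pairB)));
    last exact: (coextend_comp (free_map (idm Z) pairB)).
  rewrite mfmap_comp -!compA (comp_eq (mfstrV_nat _ _ _)) -!compA.
  by rewrite -tensm_compr rE tensm_id compmI.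
move=> eq; have Hff' : H f = H f'.
  by apply: val_inj; apply: mfmap_strV_inj; rewrite !factor eq.
apply: etrans (esym (@eval_unit_coextend _ _ B (free_rmodule Z RB) f)) _.
rewrite -/(H f) Hff'; exact: eval_unit_coextend.
Qed.

(** * Transfer of the symmetric Frobenius form *)

Section TransferredForm.
Variables (p : pivotal_structure C) (lA : hom A 𝟙).
Hypothesis lA_iso : is_iso (frob_map lA).
Hypothesis lA_sym : rotate p (lA ∘ mul A) = lA ∘ mul A.

Let omega : hom (Q ⊗ P) 𝟙 := lA ∘ pairA.
Let theta : hom (P ⊗ Q) 𝟙 := rotate p omega.

(** Hom(Z, Q) = Hom_A(Z ⊗ P, A) = Hom(Z ⊗ P, 1), by universality of [pairA] and the Frobenius
    property of A. *)
Lemma omega_nondegenerate : is_iso (transpose omega).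
Proof.
apply: nondegenerateP => [Z f|Z g g' eq].
  have [h hE] := frobenius_factor lA_iso (M := free_rmodule Z P) f.
  have [g gE] := pairA_universal h.
  by exists g; rewrite /omega -compA gE.
apply: pairA_inj; apply: (frobenius_factor_inj lA_iso
  (g := rmod_comp pairA (free_map g (rmod_idm P)))
  (g' := rmod_comp pairA (free_map g' (rmod_idm P)))).
by move: eq; rewrite /omega /= !compA.
Qed.

Lemma theta_nondegenerate : is_iso (transpose theta).
Proof. exact: rotate_nondegenerate omega_nondegenerate. Qed.

(** In elements, theta(p a, q) = lA(<q, p> a) = lA(a <q, p>) = theta(p, a q). Splitting the rotation
    past P ⊗ A lets the symmetry of [lA] act on the first half. *)
Lemma theta_balanced :
  theta ∘ (raction P ⊠ idm (rmod_obj Q))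
  = theta ∘ (idm (rmod_obj P) ⊠ actA) ∘ assoc P A Q.
Proof.
rewrite /theta -!rotate_nat rotate_tens; congr (_ ∘ _).
have -> : omega ∘ (idm (rmod_obj Q) ⊠ raction P) ∘ assoc Q P A
    = lA ∘ mul A ∘ (rmod_hom_val pairA ⊠ idm (alg_obj A)).
  by rewrite /omega -!compA -pairA_linear_right !compA.
rewrite [rotate p (lA ∘ mul A ∘ _)]rotate_nat lA_sym; congr (rotate p _).
by rewrite /omega -[RHS]compA pairA_linear_left !compA.
Qed.

Lemma symmetric_frobenius_transfer : symmetric_frobenius p B.
Proof.
have [lB lBE] := pairB_factor theta_balanced.
(* In elements, lB(b <p, q>) = theta(b p, q). *)
have pairing Z (b : hom Z B) :
    lB ∘ mul B ∘ (b ⊠ idm (alg_obj B)) ∘ (idm Z ⊠ pairB) ∘ assoc Z P Q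
    = theta ∘ ((actB ∘ (b ⊠ idm (rmod_obj P))) ⊠ idm (rmod_obj Q)).
  rewrite -lBE tensm_compl -!compA (comp_eq (esym pairB_linear_left)) -!compA.
  rewrite assoc_nat tensm_id; congr (_ ∘ (_ ∘ _)).
  by rewrite !compA -tensm_rl -tensm_lr.
apply/symmetric_frobeniusP; exists lB; split.
  apply: nondegenerateP => [Z f|Z b b' eq].
    (* The sought [b] is first found through its action on P: [g] solves theta(g(z, p), q) = f(z,
       <p, q>). *)
    have [g gE] := nondegenerate_form
      (f ∘ (idm Z ⊠ pairB) ∘ assoc Z P Q) theta_nondegenerate.
    (* Linearity of [g] can be tested against [theta]; it holds because [theta] and [pairB] are both
       balanced over A. *)
    have g_lin : rmod_hom_pred (free_rmodule Z P) P g.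
      apply/eqP; apply: (nondegenerate_form_inj theta_nondegenerate).
      rewrite /= /free_raction !tensm_compl [LHS]compA gE.
      rewrite [RHS]compA theta_balanced.
      have -> : theta ∘ (idm (rmod_obj P) ⊠ actA) ∘ assoc P A Q
          ∘ ((g ⊠ idm (alg_obj A)) ⊠ idm (rmod_obj Q))
        = theta ∘ (g ⊠ idm (rmod_obj Q))
          ∘ (idm (Z ⊗ rmod_obj P) ⊠ actA) ∘ assoc (Z ⊗ P) A Q.
        rewrite -!compA assoc_nat tensm_id [(_ ⊠ actA) ∘ _]compA.
        by rewrite [(g ⊠ _) ∘ _]compA -tensm_rl -tensm_lr.
      rewrite gE -(tensm_id Z) -!compA (comp_eq (assoc_nat _ _ _)) -!compA.
      rewrite (comp_eq (assoc_nat _ _ _)) -!compA pentagon.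
      congr (_ ∘ _); rewrite !compA -!tensm_compr; congr (_ ∘ _ ∘ _).
      by rewrite pairB_balanced.
    have [b bE] := tau_universal F_equiv (RModHom g_lin).
    exists b; apply: pairB_epi.
    apply: (inverse_pair_epi (assocK Z P Q)).
    by rewrite pairing bE.
  apply: (tau_inj F_equiv (N := RB)).
  apply: (nondegenerate_form_inj theta_nondegenerate).
  by rewrite -!pairing eq.
(* Symmetry is tested on B ⊗ P ⊗ Q. There lB(<p, q> b) = theta(p, q b) comes from omega(q b, p) =
   omega(q, b p), and two successive rotations of the latter give theta(b p, q). *)
apply: pairB_epi; apply: (inverse_pair_epi (assocK B P Q)).
have := pairing B (idm (alg_obj B)).
rewrite !tensm_id !compmI => ->.
rewrite -rotate_nat -[lB ∘ _ ∘ _]compA -pairB_linear_right.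
rewrite !compA lBE /theta -!rotate_nat.
have -> : omega ∘ (raction Q ⊠ idm (rmod_obj P))
    = omega ∘ (idm (rmod_obj Q) ⊠ actB) ∘ assoc Q B P.
  by rewrite /omega -[LHS]compA pairA_balanced !compA.
by rewrite -rotate_tens.
Qed.

End TransferredForm.
End MoritaContext.

Theorem theorem6p5 (k : fieldType) (C : finite_tensor_category k)
    (p : pivotal_structure C) (A B : algebra C) :
  symmetric_frobenius p A -> morita_equivalent B A -> symmetric_frobenius p B.
Proof.
move=> /symmetric_frobeniusP [lA [lA_iso lA_sym]] [F F_equiv].
pose P := mfobj F (regular_rmodule B).
have [Q [j [jV [/(congr1 (@rmod_hom_val _ _ _ _ _)) jVj
  /(congr1 (@rmod_hom_val _ _ _ _ _)) jjV]]]] :=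
  equivalence_ess_surj F_equiv (regular_rmodule A).
(* Fullness of F supplies [pairB] and [actA] from their prescribed images. *)
have [pairB pairBE] := mfmap_full F_equiv
  (rmod_comp (rmod_comp (raction_map P) (free_map (idm (rmod_obj P)) j))
     (mfstr F P Q)).
have [actA actAE] := mfmap_full F_equiv
  (rmod_comp (rmod_comp (rmod_comp jV (raction_map (regular_rmodule A)))
     (free_map (idm (alg_obj A)) j)) (mfstr F A Q)).
apply: (symmetric_frobenius_transfer F_equiv (conj jVj jjV) (pairB := pairB)
  (actA := actA) _ _ lA_iso lA_sym).
  by rewrite pairBE [LHS]/= -[LHS]compA (proj2 (mfstrK _ _ _)) compmI.
by rewrite actAE [LHS]/= -[LHS]compA (proj2 (mfstrK _ _ _)) compmI.
Qed.
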